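(* Let $f:[0,1]^d\to\mathbb{R}$ be integrable, let $\mathcal{P}_N=\{\boldsymbol{x}_0,\dots,\boldsymbol{x}_{N-1}\}\subset[0,1)^d$, $N=2^m$, be a digital net in base $2$, let $p\ge 1$, let $c_0,\dots,c_{2^p-1}\in[0,1]$, and put $g_p(\boldsymbol{x})=f(T_p(\boldsymbol{x}))$ for $\boldsymbol{x}\in[0,1)^d$. Then $$Q_{N,p}(f)-I(f)=\bigl(Q_p^{\mathrm{prod}}(f)-I(f)\bigr)+\bigl(Q_{\mathcal{P}_N}(g_p)-I(g_p)\bigr).$$
   Context: Digital net in base $2$: generating matrices $C_1,\dots,C_d\in\mathbb{F}_2^{\mathbb{N}\times m}$ (infinitely many rows, $m$ columns) are given. For $0\le n<N=2^m$ with $n=n_0+2n_1+\cdots+2^{m-1}n_{m-1}$, $n_i\in\{0,1\}$, let $\vec n=(n_0,\dots,n_{m-1})^\top\in\mathbb{F}_2^m$, $\vec y_{n,j}=C_j\vec n=(y_{n,j,1},y_{n,j,2},\dots)^\top\in\mathbb{F}_2^{\mathbb{N}}$ and $x_{n,j}=\sum_{r\ge1}y_{n,j,r}2^{-r}$; the points are $\boldsymbol{x}_n=(x_{n,1},\dots,x_{n,d})\in[0,1)^d$ (as a multiset). Coordinate map: for $x\in[0,1)$, $I_p(x)=\lfloor 2^p x\rfloor\in\{0,\dots,2^p-1\}$ and $T_p(x)=c_{I_p(x)}$; for $\boldsymbol{x}=(x_1,\dots,x_d)\in[0,1)^d$, $T_p(\boldsymbol{x})=(T_p(x_1),\dots,T_p(x_d))$.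 Rules: $Q_{\mathcal{P}_N}(g)=\frac1N\sum_{n=0}^{N-1}g(\boldsymbol{x}_n)$; the transformed rule is $Q_{N,p}(f)=\frac1N\sum_{n=0}^{N-1}f(T_p(\boldsymbol{x}_n))$; the complete product rule is $Q_p^{\mathrm{prod}}(f)=2^{-pd}\sum_{\boldsymbol{a}\in\{0,\dots,2^p-1\}^d}f(c_{a_1},\dots,c_{a_d})$; and $I(g)=\int_{[0,1]^d}g(\boldsymbol{x})\,d\boldsymbol{x}$. *)

(* Defs.v *)
From HB Require Import structures.
From mathcomp Require Import all_boot all_order all_algebra.
From mathcomp Require Import all_classical all_reals all_analysis.

Set Implicit Arguments.
Unset Strict Implicit.
Unset Printing Implicit Defensive.
Import Order.TTheory GRing.Theory Num.Theory.
Import numFieldNormedType.Exports.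
Local Open Scope classical_set_scope.
Local Open Scope ring_scope.

Section cons_measure.
Context {R : realType} {n : nat}.
Variable mu : {sigma_finite_measure set (n.-tuple (measurableTypeR R)) -> \bar R}.

Definition tuple_cons (z : measurableTypeR R * n.-tuple (measurableTypeR R)) : n.+1.-tuple (measurableTypeR R) :=
  [the n.+1.-tuple (measurableTypeR R) of z.1 :: z.2].

Lemma measurable_tuple_cons : measurable_fun [set: measurableTypeR R * n.-tuple (measurableTypeR R)] tuple_cons.
Proof. exact: measurable_cons. Qed.

Definition cons_measure : set (n.+1.-tuple (measurableTypeR R)) -> \bar R :=
  pushforward (@lebesgue_measure R \x mu)%E tuple_cons.

Let measurable_preimage A :
  measurable A -> measurable (tuple_cons @^-1` A).
Proof.
by move=> mA; rewrite -[X in measurable X]setTI; exact: measurable_tuple_cons.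
Qed.

Let cons_measure0 : cons_measure set0 = 0%E.
Proof. by rewrite /cons_measure /pushforward preimage_set0 measure0. Qed.

Let cons_measure_ge0 A : (0 <= cons_measure A)%E.
Proof. exact: (measure_ge0 (product_measure1 (@lebesgue_measure R) mu)). Qed.

Let cons_measure_sigma_additive : semi_sigma_additive cons_measure.
Proof.
move=> F mF tF mUF; rewrite /cons_measure /pushforward preimage_bigcup.
apply: measure_semi_sigma_additive.
- by move=> k; exact: measurable_preimage.
- apply/trivIsetP => /= i j _ _ ij; rewrite -preimage_setI.
  by move/trivIsetP : tF => /(_ _ _ _ _ ij) ->//; rewrite preimage_set0.
- by rewrite -preimage_bigcup; exact: measurable_preimage.
Qed.

HB.instance Definition _ := isMeasure.Build _ _ _ cons_measure
  cons_measure0 cons_measure_ge0 cons_measure_sigma_additive.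

Let cons_measure_sigma_finite : sigma_finite setT cons_measure.
Proof.
have /sigma_finiteP[F [TF ndF Foo]] := sigma_finiteT (@lebesgue_measure R).
have /sigma_finiteP[G [TG ndG Goo]] := sigma_finiteT mu.
exists (fun k => [set t | F k (thead t) /\ G k [tuple of behead t]]).
  apply/seteqP; split=> // t _.
  have [i _ Fi] : (\bigcup_i F i) (thead t) by rewrite -TF.
  have [j _ Gj] : (\bigcup_j G j) [tuple of behead t] by rewrite -TG.
  exists (maxn i j) => //; split.
  - by move: Fi; exact/subsetPset/ndF/leq_maxl.
  - by move: Gj; exact/subsetPset/ndG/leq_maxr.
move=> k; have [mF Fkoo] := Foo k; have [mG Gkoo] := Goo k; split.
  apply: measurableI.
  - by rewrite -[X in measurable X]setTI; exact: measurable_tnth.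
  - by rewrite -[X in measurable X]setTI; exact: measurable_behead.
rewrite /cons_measure /pushforward (_ : tuple_cons @^-1` _ = F k `*` G k).
  by rewrite product_measure1E// lte_mul_pinfty// ge0_fin_numE.
have beheadK (x : R) (t : n.-tuple (measurableTypeR R)) :
    [tuple of behead (tuple_cons (x, t))] = t by exact/val_inj.
by apply/seteqP; split=> -[x t] /=; rewrite beheadK.
Qed.

HB.instance Definition _ := @Measure_isSigmaFinite.Build _ _ _ cons_measure
  cons_measure_sigma_finite.

End cons_measure.

(* Lebesgue measure on the Borel sets of R^d, as the d-fold product of the
   one-dimensional one.  Coordinates are typed in measurableTypeR R, the copy
   of R on which lebesgue_measure is a measure. *)
Fixpoint borel_lebesgue (R : realType) (d : nat) :
    {sigma_finite_measure set (d.-tuple (measurableTypeR R)) -> \bar R} :=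
  match d with
  | 0%N => dirac [tuple]
  | d'.+1 => cons_measure (borel_lebesgue R d')
  end.

(* The completion of borel_lebesgue, so that functions are integrable in the
   usual sense of Lebesgue measurability rather than Borel measurability. *)
Definition lebesgue_type (R : realType) (d : nat) : measurableType _ :=
  caratheodory_type ((borel_lebesgue R d)^*)%mu.

Definition lebesgue (R : realType) (d : nat) :
    {measure set (lebesgue_type R d) -> \bar R} :=
  @completed_measure_extension _ _ _ (borel_lebesgue R d).

Lemma measurable_box (R : realType) (d : nat)
    (A : 'I_d -> set (measurableTypeR R)) : (forall j, measurable (A j)) ->
  measurable [set t : d.-tuple (measurableTypeR R) | forall j, A j (tnth t j)].
Proof.
move=> mA.
rewrite (_ : [set _ | _] = \bigcap_(j in [set: 'I_d]) (@tnth _ _ ^~ j @^-1` A j)).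
  apply: fin_bigcap_measurable; first exact: finite_finset.
  by move=> j _; rewrite -[X in measurable X]setTI; exact: measurable_tnth.
by apply/seteqP; split=> t /= At j; [move=> _|]; exact: At.
Qed.

Lemma borel_lebesgue_box (R : realType) (d : nat)
    (A : 'I_d -> set (measurableTypeR R)) : (forall j, measurable (A j)) ->
  borel_lebesgue R d [set t | forall j, A j (tnth t j)] =
  (\prod_(j < d) lebesgue_measure (A j))%E.
Proof.
elim: d A => [|d IHd] A mA /=.
  by rewrite big_ord0 diracE mem_set//= => -[].
rewrite big_ord_recl /cons_measure /pushforward.
rewrite (_ : _ @^-1` _ = A ord0 `*`
  [set t | forall j, A (lift ord0 j) (tnth t j)]); last first.
  apply/seteqP; split=> -[x t] /= => [Axt|[Ax At] j].
    split; first exact: (Axt ord0).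
    by move=> j; have := Axt (lift ord0 j); rewrite tnthS.
  by case: (unliftP ord0 j) => [k ->|->//]; rewrite tnthS.
have mAl := measurable_box (fun j => mA (lift ord0 j)).
rewrite (product_measure1E _ _ (mA ord0) mAl); congr (_ * _)%E.
exact: (IHd (fun j => A (lift ord0 j))
  (fun j => mA (lift ord0 j))).
Qed.

Lemma lebesgue_box (R : realType) (d : nat)
    (A : 'I_d -> set (measurableTypeR R)) : (forall j, measurable (A j)) ->
  lebesgue R d [set t | forall j, A j (tnth t j)] =
  (\prod_(j < d) lebesgue_measure (A j))%E.
Proof.
move=> mA; rewrite -borel_lebesgue_box//.
by apply: measurable_mu_extE; apply: measurable_box.
Qed.

Definition cube (R : realType) (d : nat) : set (d.-tuple R) :=
  [set x | forall j, 0 <= tnth x j <= 1].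
Arguments cube : clear implicits.

Definition cube_co (R : realType) (d : nat) : set (d.-tuple R) :=
  [set x | forall j, 0 <= tnth x j < 1].
Arguments cube_co : clear implicits.

Section quadrature.
Context {R : realType}.

Definition integrable_on_cube (d : nat) (g : d.-tuple R -> R) : Prop :=
  (lebesgue R d).-integrable (cube R d) (EFin \o g).

Definition cube_integral (d : nat) (g : d.-tuple R -> R) : R :=
  \int[lebesgue R d]_(x in cube R d) g x.

Definition digit_vector (m n : nat) : 'cV['F_2]_m :=
  \col_(i < m) ((n %/ 2 ^ i) %% 2)%:R.

(* A generating matrix with infinitely many rows is the sequence of its rows,
   numbered from 0: row r yields the digit of weight 2^-(r+1). *)
Definition output_digit (m : nat) (Cj : nat -> 'rV['F_2]_m) (n r : nat) : 'F_2 :=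
  (Cj r *m digit_vector m n) ord0 ord0.

Definition net_coord (m : nat) (Cj : nat -> 'rV['F_2]_m) (n : nat) : R :=
  limn (series (fun r =>
    (nat_of_ord (output_digit Cj n r))%:R / 2 ^+ r.+1 : R)).

Definition digital_net (d m : nat) (C : 'I_d -> nat -> 'rV['F_2]_m)
    (n : 'I_(2 ^ m)) : d.-tuple R :=
  [tuple net_coord (C j) n | j < d].

Definition cell_index (p : nat) (x : R) : nat := `|Num.floor (2 ^+ p * x)|%N.

(* The default value 0 is never used when x lies in [0, 1). *)
Definition coord_map (p : nat) (c : (2 ^ p).-tuple R) (x : R) : R :=
  nth 0 c (cell_index p x).

Definition point_map (d p : nat) (c : (2 ^ p).-tuple R) (x : d.-tuple R) :
    d.-tuple R :=
  [tuple coord_map c (tnth x j) | j < d].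

(* x |-> f (T_p x) makes sense on [0, 1)^d only; it is extended by 0, which
   affects its integral over [0, 1]^d on a null set only. *)
Definition pullback (d p : nat) (c : (2 ^ p).-tuple R) (f : d.-tuple R -> R) :
    d.-tuple R -> R :=
  (f \o point_map c) \_ (cube_co R d).

Definition qmc_rule (d N : nat) (P : 'I_N -> d.-tuple R) (g : d.-tuple R -> R) :
    R :=
  N%:R^-1 * \sum_(n < N) g (P n).

Definition transformed_rule (d N p : nat) (c : (2 ^ p).-tuple R)
    (P : 'I_N -> d.-tuple R) (f : d.-tuple R -> R) : R :=
  N%:R^-1 * \sum_(n < N) f (point_map c (P n)).

Definition product_rule (d p : nat) (c : (2 ^ p).-tuple R)
    (f : d.-tuple R -> R) : R :=
  2 ^- (p * d) *
  \sum_(a : d.-tuple 'I_(2 ^ p)) f [tuple tnth c (tnth a j) | j < d].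

End quadrature.

(* Main.v *)
Require Import Defs.
From mathcomp Require Import all_boot all_order all_algebra.
From mathcomp Require Import all_classical all_reals all_analysis.
From mathcomp Require Import measurable_realfun.

Set Implicit Arguments.
Unset Strict Implicit.
Unset Printing Implicit Defensive.
Import Order.TTheory GRing.Theory Num.Theory.
Local Open Scope classical_set_scope.
Local Open Scope ring_scope.

(* The map T_p is constant on each of the 2^(pd) half-open dyadic boxes of side
   2^-p, which tile [0,1)^d and have volume 2^-(pd).  Hence the pullback of f is
   a step function whose integral is exactly the complete product rule, and the
   identity follows since the net points lie in [0,1)^d. *)

(** Finite measure makes each indicator integrable on [D], so the integral passes through the finite
    sum and the scalars, whatever the signs of [v]. *)
Lemma integral_step d (T : measurableType d) (R : realType)
    (mu : {measure set T -> \bar R}) (D : set T) (I : finType)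
    (A : I -> set T) (v : I -> R) :
  measurable D -> (forall i, measurable (A i)) ->
  (forall i, A i `<=` D) -> (forall i, (mu (A i) < +oo)%E) ->
  (\int[mu]_(x in D) (\sum_i v i * \1_(A i) x)%:E =
   \sum_i (v i)%:E * mu (A i))%E.
Proof.
move=> mD mA AD Aoo.
have iA i : mu.-integrable D (fun x => (\1_(A i) x)%:E).
  apply/integrableP; split.
    by apply/measurable_EFinP/measurable_indic.
  under eq_integral do rewrite gee0_abs ?lee_fin//.
  by rewrite integral_indic// (setIidl (AD i)).
under eq_integral do rewrite -sumEFin.
rewrite integral_sum//; last first.
  by move=> i; under eq_fun do rewrite EFinM; exact: integrableZl.
apply: eq_bigr => i _; under eq_integral do rewrite EFinM.
by rewrite integralZl// integral_indic// (setIidl (AD i)).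
Qed.

Section dyadic_cells.
Context {R : realType}.

Definition dyadic_cell (p i : nat) : set (measurableTypeR R) :=
  [set` `[i%:R / 2 ^+ p, i.+1%:R / 2 ^+ p[ ].

(** Scaling by [2 ^+ p] turns membership into the bounds that characterise the floor. The sign
    condition matters because [cell_index] takes the absolute value of that floor. *)
Lemma dyadic_cellE p i (x : R) :
  0 <= x -> dyadic_cell p i x <-> cell_index p x = i.
Proof.
move=> x0; rewrite /dyadic_cell /cell_index /= in_itv/=.
have px0 : 0 <= 2 ^+ p * x by rewrite mulr_ge0// exprn_ge0.
rewrite ler_pdivrMr ?exprn_gt0// ltr_pdivlMr ?exprn_gt0// [x * _]mulrC.
split=> [ix|<-].
  have -> : Num.floor (2 ^+ p * x) = i%:Z.
    by apply: floor_def; rewrite intrD -!pmulrn natr1.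
  by rewrite absz_nat.
have := floor_itv (2 ^+ p * x); rewrite intrD.
have : 0 <= Num.floor (2 ^+ p * x) by rewrite floor_ge0.
by case: (Num.floor _) => // n _; rewrite -!pmulrn natr1.
Qed.

Lemma cell_index_lt p (x : R) : 0 <= x < 1 -> (cell_index p x < 2 ^ p)%N.
Proof.
move=> /andP[x0 x1].
(* The trivial equality places [x] in its own cell, whose left end is then at most [x], hence below
   1. *)
have /(dyadic_cellE p _ x0) : cell_index p x = cell_index p x by [].
rewrite /dyadic_cell/= in_itv/= => /andP[+ _].
rewrite ler_pdivrMr ?exprn_gt0// => h.
rewrite -(ltr_nat R) natrX (le_lt_trans h)//.
by rewrite gtr_pMl ?exprn_gt0.
Qed.

Lemma dyadic_cell_sub p i :
  (i < 2 ^ p)%N -> dyadic_cell p i `<=` [set x | 0 <= x < 1].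
Proof.
move=> ip x; rewrite /dyadic_cell/= in_itv/= => /andP[ix xi].
apply/andP; split.
  by apply: le_trans ix; rewrite divr_ge0// exprn_ge0.
apply: lt_le_trans xi _.
by rewrite ler_pdivrMr ?exprn_gt0// mul1r -natrX ler_nat.
Qed.

Lemma measurable_dyadic_cell p i : measurable (dyadic_cell p i).
Proof. exact: measurable_itv. Qed.

Lemma lebesgue_measure_dyadic_cell p i :
  lebesgue_measure (dyadic_cell p i) = (2 ^- p)%:E :> \bar R.
Proof.
rewrite lebesgue_measure_itv/= lte_fin ltr_pM2r ?invr_gt0 ?exprn_gt0//.
by rewrite ltr_nat ltnSn -EFinB -mulrBl -natr1 addrC addKr mul1r.
Qed.

Definition dyadic_box (d p : nat) (a : d.-tuple 'I_(2 ^ p)) :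
    set (d.-tuple (measurableTypeR R)) :=
  [set x | forall j, dyadic_cell p (tnth a j) (tnth x j)].

Lemma measurable_dyadic_box d p (a : d.-tuple 'I_(2 ^ p)) :
  measurable (dyadic_box a : set (lebesgue_type R d)).
Proof.
(* Borel sets remain measurable for the completed measure, so the Borel statement for boxes
   suffices. *)
apply: (@caratheodory_measurable_mu_ext _ _ _ (borel_lebesgue R d)).
apply: (@measurable_box R d (fun j => dyadic_cell p (tnth a j))) => j.
exact: measurable_dyadic_cell.
Qed.

Lemma lebesgue_dyadic_box d p (a : d.-tuple 'I_(2 ^ p)) :
  lebesgue R d (dyadic_box a) = (2 ^- (p * d))%:E.
Proof.
rewrite /dyadic_box.
have mA (j : 'I_d) := measurable_dyadic_cell p (tnth a j).
rewrite (lebesgue_box mA).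
under eq_bigr do rewrite lebesgue_measure_dyadic_cell.
by rewrite prodEFin prodr_const card_ord exprVn exprM.
Qed.

Lemma dyadic_box_sub_cube_co d p (a : d.-tuple 'I_(2 ^ p)) :
  dyadic_box a `<=` cube_co R d.
Proof. by move=> x ax j; exact: (dyadic_cell_sub (ltn_ord _) (ax j)). Qed.

Lemma cube_co_sub_cube d : cube_co R d `<=` cube R d.
Proof. by move=> x xc j; have /andP[-> /ltW ->] := xc j. Qed.

Lemma measurable_cube d : measurable (cube R d : set (lebesgue_type R d)).
Proof.
apply: (@caratheodory_measurable_mu_ext _ _ _ (borel_lebesgue R d)).
rewrite (_ : cube R d = [set x | forall j, [set` `[0, 1]%R] (tnth x j)]).
  by apply: (@measurable_box R d (fun=> [set` `[0, 1]%R])) => j; exact: measurable_itv.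
by apply/seteqP; split=> x /= xc j; have := xc j; rewrite in_itv.
Qed.

Lemma point_map_dyadic_box d p (c : (2 ^ p).-tuple R)
    (a : d.-tuple 'I_(2 ^ p)) (x : d.-tuple R) :
  dyadic_box a x -> point_map c x = [tuple tnth c (tnth a j) | j < d].
Proof.
move=> ax; apply: eq_from_tnth => j; rewrite !tnth_mktuple /coord_map.
have /andP[x0 _] := dyadic_box_sub_cube_co ax j.
have /(dyadic_cellE p _ x0) -> := ax j.
(* The index is an ordinal below [2 ^ p], so the default value 0 of [nth] is never reached. *)
by rewrite -tnth_nth.
Qed.

(** The vector of cell indices of the coordinates is the only candidate. The equivalence records
    covering and disjointness at once, so a sum of box indicators at [x] has exactly one nonzero
    term. *)
Lemma cube_co_dyadic_box d (p : nat) (x : d.-tuple R) :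
  cube_co R d x ->
  exists a : d.-tuple 'I_(2 ^ p), forall b, dyadic_box b x <-> b = a.
Proof.
move=> xc.
exists [tuple Ordinal (cell_index_lt p (xc j)) | j < d] => b; split=> [bx|->].
  apply: eq_from_tnth => j; rewrite tnth_mktuple; apply: val_inj => /=.
  have /andP[x0 _] := xc j.
  by have /(dyadic_cellE p _ x0) := bx j.
move=> j; rewrite tnth_mktuple /=; have /andP[x0 _] := xc j.
by apply/(dyadic_cellE p _ x0).
Qed.

(** This holds at every point, not just almost everywhere: the extension by 0 agrees with the
    indicators, which all vanish outside [cube_co R d]. *)
Lemma pullbackE d p (c : (2 ^ p).-tuple R) (f : d.-tuple R -> R)
    (x : d.-tuple R) :
  pullback c f x = \sum_(a : d.-tuple 'I_(2 ^ p))
    f [tuple tnth c (tnth a j) | j < d] * \1_(dyadic_box a) x.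
Proof.
rewrite /pullback patchE; case: ifPn => [/set_mem xc|/negP xNc].
  have [a ax] := cube_co_dyadic_box p xc.
  rewrite (bigD1 a)//= [X in _ + X]big1 ?addr0; last first.
    move=> b ba; rewrite indicE memNset ?mulr0// => /ax.
    exact/eqP.
  rewrite indicE mem_set ?mulr1; last exact/ax.
  by rewrite (point_map_dyadic_box c (a := a))//; exact/ax.
rewrite big1// => a _; rewrite indicE memNset ?mulr0// => ax.
by apply/xNc/mem_set; exact: dyadic_box_sub_cube_co ax.
Qed.

(** All boxes have the same volume, which is the common weight of the product rule. *)
Lemma cube_integral_pullback d p (c : (2 ^ p).-tuple R) (f : d.-tuple R -> R) :
  cube_integral (pullback c f) = product_rule c f.
Proof.
rewrite /cube_integral /Rintegral.
under eq_integral do rewrite pullbackE.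
rewrite (@integral_step _ _ _ (lebesgue R d) (cube R d) _ (@dyadic_box d p)).
- under eq_bigr do rewrite lebesgue_dyadic_box -EFinM.
  by rewrite sumEFin /= /product_rule -mulr_suml mulrC.
- exact: measurable_cube.
- exact: measurable_dyadic_box.
- move=> a; apply: subset_trans (@cube_co_sub_cube d).
  exact: dyadic_box_sub_cube_co.
- by move=> a; rewrite lebesgue_dyadic_box ltry.
Qed.

Lemma qmc_rule_pullback d N p (c : (2 ^ p).-tuple R) (P : 'I_N -> d.-tuple R)
    (f : d.-tuple R -> R) :
  (forall n, cube_co R d (P n)) ->
  qmc_rule P (pullback c f) = transformed_rule c P f.
Proof.
move=> Pc; congr (_ * _); apply: eq_bigr => n _.
by rewrite /pullback patchE mem_set.
Qed.

End dyadic_cells.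

Theorem mainTheorem1 (R : realType) (d m p : nat)
    (f : d.-tuple R -> R) (hf : integrable_on_cube f)
    (C : 'I_d -> nat -> 'rV['F_2]_m)
    (hP : forall n : 'I_(2 ^ m), cube_co R d (digital_net C n))
    (hp : (1 <= p)%N)
    (c : (2 ^ p).-tuple R) (hc : forall i, 0 <= tnth c i <= 1) :
  transformed_rule c (digital_net C) f - cube_integral f =
  (product_rule c f - cube_integral f) +
  (qmc_rule (digital_net C) (pullback c f) - cube_integral (pullback c f)).
Proof.
rewrite cube_integral_pullback qmc_rule_pullback//.
(* With both pullback terms evaluated, the product rule occurs with opposite signs and cancels. *)
by rewrite [RHS]addrC addrA subrK.
Qed.
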